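(* Let $(\mathcal{A}^{V},X,\Phi)$ be a symbolic dynamical system with a moving subsymmetry $\tau$. If $X$ has weak independence, and there exists some $v\in V$ with superlinear connectivity (in the network $(V,\to)$ of $\Phi$) such that $\overline{h}_v(X)>0$, then the system $(X,\Phi)$ is not posexpansive.
   Context: Let $\mathcal{A}$ be a finite set with the discrete topology and $V$ a countably infinite set; $\mathcal{A}^{V}$ has the product topology. A pattern space is a closed perfect subset $X\subseteq\mathcal{A}^{V}$. A symbolic dynamical system is a triple $(\mathcal{A}^{V},X,\Phi)$ where $X\subseteq \mathcal{A}^V$ is a pattern space and $\Phi:\mathcal{A}^{V}\to\mathcal{A}^{V}$ is continuous with $\Phi(X)\subseteq X$. For $U\subseteq V$ and $x\in X$, $x_U:=(x_u)_{u\in U}$ and $X_U:=\{x_U : x\in X\}$. Network: by continuity, for each $w\in V$ the set $\Phi_{\mathrm{in}}(w)$ of those $v\in V$ on which $\Phi(\cdot)_w$ depends nontrivially (there are $a,a'\in\mathcal{A}^V$ differing only at $v$ with $\Phi(a)_w\ne\Phi(a')_w$) is finite, and $\Phi(a)_w$ is a function of $a_{\Phi_{\mathrm{in}}(w)}$. The network of $\Phi$ is the digraph on $V$ with $v\to w$ iff $v\in\Phi_{\mathrm{in}}(w)$. Balls: for $U\subseteq V$, $B(U,1):=U\cup\{v\in V:\exists u\in U,\ v\to u\}$ and $B(U,n+1):=B(B(U,n),1)$ for $n\ge 1$; $B(v,r):=B(\{v\},r)$. A ball is a set of the form $B(v,r)$. Superlinear connectivity of $v$: $\liminf_{r\to\infty}|B(v,r)|/r=\infty$.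 Upper entropy: $\overline{h}_v(X):=\limsup_{r\to\infty}\frac{\log_2|X_{B(v,r)}|}{|B(v,r)|}$. Weak independence of $X$: there is a constant $\epsilon>0$ such that for any pairwise disjoint balls $B_1,\dots,B_N\subset V$, $\log_2|X_{B_1\sqcup\cdots\sqcup B_N}|\ge \epsilon\sum_{n=1}^N\log_2|X_{B_n}|$. Subsymmetries: a subisometry is an injection $\tau:V\to V$ such that $v\to w\iff\tau(v)\to\tau(w)$ for all $v,w\in V$. Define $\tau_*:\mathcal{A}^V\to\mathcal{A}^V$ by $\tau_*(a)_v:=a_{\tau(v)}$. A subsymmetry of $(\mathcal{A}^V,X,\Phi)$ is a subisometry $\tau$ with $\tau_*(X)=X$ and $\tau_*\circ\Phi=\Phi\circ\tau_*$. Let $d(v,w)$ be the length of the shortest undirected path from $v$ to $w$ in $(V,\to)$ ($d(v,w)=\infty$ if there is none), and $\mathrm{speed}(v,\tau):=\lim_{n\to\infty}d(v,\tau^n(v))/n$. A subsymmetry $\tau$ is moving if $\mathrm{speed}(v,\tau)>0$ for all $v\in V$. Posexpansive: $(X,\Phi)$ is posexpansive if there is a finite $W\subset V$ such that the map $x\mapsto (x_W,\Phi(x)_W,\Phi^2(x)_W,\dots)$ is injective on $X$ (equivalently, $(X,\Phi)$ is topologically conjugate to a one-sided shift). *)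

(* Defs.v *)
From mathcomp Require Import all_boot all_order all_algebra.
From mathcomp Require Import finmap all_classical all_reals all_analysis.

Import Order.TTheory GRing.Theory Num.Theory.
Import numFieldNormedType.Exports.

Local Open Scope classical_set_scope.
Local Open Scope ring_scope.

(* A^V with the product topology, A being discrete. *)
Notation config V A := (prod_topology (fun _ : V => discrete_topology A)).

Section SymbolicDynamics.
Context {R : realType} {V : choiceType} {A : finType}.
Implicit Types (X : set (config V A)) (Phi : config V A -> config V A).
Implicit Types (U W : set V) (v w : V) (tau : V -> V) (r n : nat).

(* In mathcomp-analysis [perfect_set] includes closedness. *)
Definition pattern_space X : Prop := perfect_set X.

Record symbolic_system X Phi : Prop := SymbolicSystem {
  sds_pattern : pattern_space X ;
  sds_continuous : continuous Phi ;
  sds_invariant : Phi @` X `<=` X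
}.

Definition restrictions X U : set (U -> A) :=
  (fun x : config V A => sigL U (x : V -> A)) @` X.

Definition inputs Phi w : set V :=
  [set v | exists a a' : config V A,
     (forall u, u <> v -> a u = a' u) /\ Phi a w <> Phi a' w].

Definition arrow Phi v w : Prop := inputs Phi w v.

Definition ball_step Phi U : set V :=
  U `|` [set v | exists2 u, U u & arrow Phi v u].

(* B(U, r); the radii of actual balls are r >= 1, and r = 0 returns U. *)
Definition net_ball Phi U r : set V := iter r (ball_step Phi) U.

Definition pball Phi v r : set V := net_ball Phi [set v] r.

Definition is_net_ball Phi U : Prop :=
  exists v r, (0 < r)%N /\ U = pball Phi v r.

(* The cardinality of a finite set; it is 0 on infinite sets, but is only
   applied to balls of continuous maps and to restrictions to finite sets. *)
Definition finite_card {T : choiceType} (S : set T) : nat := #|` fset_set S|.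

Definition log2 (x : R) : R := ln x / ln 2.

(* log_2 |X_U|; the mathcomp convention ln 0 = 0 matters only when X is empty. *)
Definition log_card X U : R := log2 (finite_card (restrictions X U))%:R.

Definition superlinear_connectivity Phi v : Prop :=
  limn_einf (fun r => ((finite_card (pball Phi v r))%:R / r%:R : R)%:E) = +oo%E.

Definition upper_entropy Phi X v : \bar R :=
  limn_esup (fun r =>
    (log_card X (pball Phi v r) / (finite_card (pball Phi v r))%:R)%:E).

Definition weak_independence Phi X : Prop :=
  exists2 eps : R, 0 < eps &
    forall (N : nat) (B : 'I_N -> set V),
      (forall i, is_net_ball Phi (B i)) -> trivIset [set: 'I_N] B ->
      eps * (\sum_(i < N) log_card X (B i)) <= log_card X (\bigcup_i B i).

Definition subisometry Phi tau : Prop :=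
  injective tau /\ forall v w, arrow Phi v w <-> arrow Phi (tau v) (tau w).

Definition pullback tau (a : config V A) : config V A := fun v => a (tau v).

Definition subsymmetry X Phi tau : Prop :=
  [/\ subisometry Phi tau,
      pullback tau @` X = X &
      pullback tau \o Phi = Phi \o pullback tau].

(* The length of a shortest undirected path, +oo if there is none (the infimum
   of the empty set). *)
Definition net_dist Phi v w : \bar R :=
  ereal_inf [set (size p)%:R%:E | p in
    [set p : seq V |
       path (fun x y => `[< arrow Phi x y \/ arrow Phi y x >]) v p
       /\ last v p = w]].

Definition speed_seq Phi tau v : nat -> \bar R :=
  fun n => (net_dist Phi v (iter n tau v) * (n%:R^-1)%:E)%E.

Definition speed Phi tau v : \bar R := limn (speed_seq Phi tau v).

(* [limn] is total, so the existence of the limit (in the extended reals) is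
   stated separately. *)
Definition moving Phi tau : Prop :=
  forall v, cvgn (speed_seq Phi tau v) /\ (0 < speed Phi tau v)%E.

Definition posexpansive X Phi : Prop :=
  exists2 W : set V, finite_set W &
    set_inj X (fun (x : config V A) (n : nat) =>
                 sigL W (iter n Phi x : V -> A)).

End SymbolicDynamics.

Arguments superlinear_connectivity R {V A} Phi v.
Arguments upper_entropy R {V A} Phi X v.
Arguments weak_independence R {V A} Phi X.
Arguments moving R {V A} Phi tau.

(* Main.v *)
Require Import Defs.
From mathcomp Require Import all_boot all_order all_algebra.
From mathcomp Require Import finmap all_classical all_reals all_analysis.
Import Order.TTheory GRing.Theory Num.Theory.
Import numFieldNormedType.Exports.
Local Open Scope classical_set_scope.
Local Open Scope ring_scope.

(* Suppose the orbit of x seen through the finite window W determines x. By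
   compactness, x on tau(W) is determined by T steps of that orbit, so, tau
   commuting with Phi, the window tau^k(W) is read off W with a delay of only
   k T. Because tau is moving, the balls
   B(tau^(M r k)(v), r) = tau^(M r k)(B(v, r)) are pairwise disjoint for a
   constant M. Seeing N of them takes time N M r T + O(1) as N grows, hence
   they carry at most L (N M r T + O(1)) bits, whereas weak independence gives
   at least eps N log_2 |X_B(v, r)|. Letting N tend to infinity,
   log_2 |X_B(v, r)| = O(r), against superlinear connectivity and positive
   entropy. *)

(** * Determination of coordinates by an orbit seen in a window *)

Section Determination.
Context {V : choiceType} {A : finType}.
Implicit Types (X : set (config V A)) (Phi : config V A -> config V A).
Implicit Types (U W : set V) (v w : V) (tau : V -> V) (T : nat).

Lemma compact_config : compact [set: config V A].
Proof.
have -> : [set: config V A]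
    = [set f | forall i, [set: discrete_topology A] (f i)] by apply/seteqP.
apply: (@tychonoff V (fun=> discrete_topology A) (fun=> setT)) => _.
apply: finite_compact; exact: (@finite_finset A setT).
Qed.

Lemma iter_continuous (T : topologicalType) (f : T -> T) n :
  continuous f -> continuous (iter n f).
Proof.
move=> cf; elim: n => [|n IHn] x; first exact: cvg_id.
exact: (@continuous_comp _ _ _ (iter n f) f x (IHn x) (cf _)).
Qed.

(** Singletons of the discrete alphabet are open, so coordinates of a continuous map are locally
    constant. *)
Lemma near_coordE (f : config V A -> config V A) v (x : config V A) :
  continuous f -> \forall y \near x, (f y v : A) = f x v.
Proof.
move=> cf.
have cv : {for x, continuous (fun y => f y v : discrete_topology A)}.
  exact: (@continuous_comp _ _ _ f (@proj V (fun=> discrete_topology A) v) x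
    (cf x) (@proj_continuous V (fun=> discrete_topology A) v _)).
by have /= := cv [set f x v] (discrete_set1 _).
Qed.

(** The time bound is inclusive: the observation consists of [T.+1] snapshots. *)
Definition window_determines X Phi W T U : Prop :=
  forall x y, X x -> X y ->
    (forall n, (n <= T)%N -> forall w, W w -> iter n Phi x w = iter n Phi y w) ->
    forall u, U u -> x u = y u.

(** Compactness of the square of [X] makes the time uniform: near a pair agreeing at [u] the
    conclusion persists, and near any other pair one separating time and coordinate keep refuting
    the hypothesis. *)
Lemma posexpansive_determines1 X Phi W u : closed X -> continuous Phi ->
  set_inj X (fun (x : config V A) (n : nat) => sigL W (iter n Phi x : V -> A)) ->
  \forall T \near \oo, window_determines X Phi W T [set u].
Proof.
move=> clX cPhi injW.
have cX : compact X by apply: subclosed_compact clX compact_config _.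
have /compact_near_coveringP cXX := compact_setX cX cX.
pose P T (p : config V A * config V A) :=
  (forall n, (n <= T)%N -> forall w, W w -> iter n Phi p.1 w = iter n Phi p.2 w) ->
  p.1 u = p.2 u.
have := cXX nat \oo P _ _.
move=> /(_ _ _) H.
apply: filterS (H _) => [T HT x y Xx Xy Wxy _ ->|].
  exact: (HT (x, y)).
move=> [x y] [/= Xx Xy].
have [exy|nxy] := eqVneq (x u) (y u).
  have hx := @near_coordE id u x (fun=> cvg_id).
  have hy := @near_coordE id u y (fun=> cvg_id).
  exists ([set p | p.1 u = x u /\ p.2 u = y u], setT).
    split; last exact: filterT.
    by exists ([set x' | x' u = x u], [set y' | y' u = y u]) => // -[].
  by move=> [[x' y'] T] /= [[hx' hy'] _] _ /=; rewrite hx' hy'.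
have [n [w [Ww nw]]] : exists n w, W w /\ iter n Phi x w <> iter n Phi y w.
  apply: contrapT => nE; move: nxy; rewrite (injW x y) ?inE ?eqxx//.
  apply/funext => n; apply/funext => -[w Ww]; rewrite /sigL /=.
  by apply: contrapT => nw; apply: nE; exists n, w; split; [exact: set_mem|].
have hx := near_coordE (iter n Phi) w x (iter_continuous _ Phi n cPhi).
have hy := near_coordE (iter n Phi) w y (iter_continuous _ Phi n cPhi).
exists ([set p | iter n Phi p.1 w = iter n Phi x w /\
                 iter n Phi p.2 w = iter n Phi y w], [set T | (n <= T)%N]).
  split; last exact: nbhs_infty_ge.
  by exists ([set x' | iter n Phi x' w = iter n Phi x w],
             [set y' | iter n Phi y' w = iter n Phi y w]) => // -[].
move=> [[x' y'] T] /= [[hx' hy'] nT] /(_ n nT w Ww).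
by rewrite /= hx' hy'.
Qed.

Lemma posexpansive_determines X Phi W U : closed X -> continuous Phi ->
  set_inj X (fun (x : config V A) (n : nat) => sigL W (iter n Phi x : V -> A)) ->
  finite_set U -> exists T, window_determines X Phi W T U.
Proof.
move=> clX cPhi injW /finite_fsetP[F ->].
have := @filter_bigI _ _ F
  (fun u T => window_determines X Phi W T [set u]) \oo eventually_filter.
move=> /(_ (fun u _ => posexpansive_determines1 X Phi W u clX cPhi injW)).
move=> /(@filter_ex _ \oo eventually_filter)[T HT]; exists T => x y Xx Xy Wxy u Fu.
exact: (HT u Fu x y Xx Xy Wxy).
Qed.

(** Delays add: applied to [iter n Phi x] and [iter n Phi y], which stay in [X], the first
    determination gives agreement on [U] at every time [n <= T']. *)
Lemma window_determines_window X Phi W T U T' U' :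
  Phi @` X `<=` X ->
  window_determines X Phi W T U -> window_determines X Phi U T' U' ->
  window_determines X Phi W (T' + T) U'.
Proof.
move=> PhiX WU UU' x y Xx Xy Wxy; apply: (UU' _ _ Xx Xy) => n nT'.
have Xi z : X z -> X (iter n Phi z).
  move=> Xz; elim: n {nT'} => //= n IHn; apply: PhiX.
  by exists (iter n Phi z).
apply: (WU _ _ (Xi _ Xx) (Xi _ Xy)) => m mT w Ww.
rewrite -!iterD; apply: Wxy => //; by rewrite addnC leq_add.
Qed.

(** Seeing [x] on the image of [W] is seeing [pullback sigma x] on [W], and pulling back preserves
    [X] and commutes with [Phi]. *)
Lemma window_determines_pullback X Phi W T U sigma :
  pullback sigma @` X `<=` X ->
  (forall a, pullback sigma (Phi a) = Phi (pullback sigma a)) ->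
  window_determines X Phi W T U ->
  window_determines X Phi (sigma @` W) T (sigma @` U).
Proof.
move=> sX sPhi WU x y Xx Xy Wxy _ [u Uu <-].
have sPhin n a : pullback sigma (iter n Phi a) = iter n Phi (pullback sigma a).
  by elim: n => //= n <-; rewrite sPhi.
have sXi z : X z -> X (pullback sigma z) by move=> Xz; apply: sX; exists z.
apply: (WU _ _ (sXi _ Xx) (sXi _ Xy)) Uu => n nT w Ww.
by rewrite -!sPhin /pullback; exact: Wxy.
Qed.

End Determination.

(** * Counting patterns *)

Lemma finite_card_image_le {S : Type} {T T' : choiceType} (D : set S)
    (f : S -> T) (g : S -> T') :
  finite_set (f @` D) ->
  (forall x y, D x -> D y -> f x = f y -> g x = g y) ->
  finite_set (g @` D) /\ (finite_card (g @` D) <= finite_card (f @` D))%N.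
Proof.
move=> finf fg; have [->|/set0P[x0 Dx0]] := eqVneq D set0.
  by rewrite !image_set0; split => //; rewrite /finite_card !fset_set0.
(* [g] factors through [f] on [D]; the value [g x0] only makes [h] total. *)
pose h t := if pselect (exists2 x, D x & f x = t) is left e
  then g (projT1 (cid2 e)) else g x0.
have -> : g @` D = h @` (f @` D).
  rewrite image_comp; apply: eq_imagel => x Dx /=; rewrite /h.
  case: pselect => [e|[]]; last by exists x.
  by case: (cid2 e) => y /= Dy fy; apply: fg.
split; first exact: finite_image.
by rewrite /finite_card fset_set_image // leq_imfset_card.
Qed.

Lemma finite_card_finType_le {T : finType} (D : set T) :
  (finite_card D <= #|T|)%N.
Proof.
by rewrite /finite_card -(card_uniqP (fset_uniq (fset_set D))) max_card.
Qed.

Section Counting.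
Context {R : realType} {V : choiceType} {A : finType}.
Implicit Types (X : set (config V A)) (Phi : config V A -> config V A).
Implicit Types (U W : set V) (m n : nat).

Lemma ler_log2_nat m n : (m <= n)%N -> log2 m%:R <= log2 n%:R :> R.
Proof.
move=> mn; rewrite /log2 ler_pM2r ?invr_gt0 ?ln_gt0 ?ltr1n//.
case: m mn => [_|m mn]; last first.
  by rewrite ler_ln ?posrE ?ltr0n ?ler_nat ?(leq_trans _ mn).
(* For [m = 0] the convention [ln 0 = 0] makes the left side vanish. *)
rewrite ln0//; case: n => [|n]; first by rewrite ln0.
by rewrite ln_ge0 // ler1n.
Qed.

Lemma log2_natX m n : log2 (m ^ n)%N%:R = log2 m%:R *+ n :> R.
Proof.
rewrite /log2 natrX -mulrnAl; case: m => [|m]; last by rewrite lnXn ?ltr0n.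
by case: n => [|n]; rewrite ?ln1 // expr0n /= ln0 // mul0rn.
Qed.

(* The orbit code [x_W, Phi(x)_W, ..., Phi^T(x)_W] takes at most
   [(|A|^|W|)^(T+1)] values. *)
Lemma window_determines_card X Phi W T U :
  finite_set W -> window_determines X Phi W T U ->
  finite_set (restrictions X U) /\
  log_card X U <= log2 (#|A| ^ finite_card W)%N%:R *+ T.+1 :> R.
Proof.
move=> finW WU.
pose code (x : config V A) := [ffun p : 'I_T.+1 * fset_set W =>
  (iter p.1 Phi x (val p.2) : A)].
have [||finU leU] := @finite_card_image_le _ _ _ X code
  (fun x : config V A => sigL U (x : V -> A)).
- exact: finite_finset.
- move=> x y Xx Xy /ffunP exy; apply/eq_sigLP => u /set_mem Uu.
  apply: (WU x y Xx Xy _ u Uu) => n nT w Ww.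
  have wW : w \in fset_set W by rewrite in_fset_set// inE.
  have := exy (Ordinal (n := T.+1) nT, FSetSub wW); by rewrite !ffunE.
split => //; rewrite -log2_natX; apply: ler_log2_nat.
apply: leq_trans leU _; apply: leq_trans (finite_card_finType_le _) _.
by rewrite card_ffun card_prod card_ord -cardfE -expnM mulnC.
Qed.

(** As [X] is its own pullback, patterns on [U] are read off patterns on its image; finiteness keeps
    the default value [0] of [finite_card] off the right side. *)
Lemma log_card_pullback X U (sigma : V -> V) :
  pullback sigma @` X = X -> finite_set (restrictions X (sigma @` U)) ->
  log_card X U <= log_card X (sigma @` U) :> R.
Proof.
move=> sX finU; apply: ler_log2_nat.
have -> : restrictions X U =
    (fun x : config V A => sigL U (pullback sigma x : V -> A)) @` X.
  by rewrite /restrictions -{1}sX image_comp.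
apply: (proj2 (finite_card_image_le _ _ _ finU _)) => x y Xx Xy.
move=> /eq_sigLP exy; apply/eq_sigLP => u /set_mem Uu.
by apply: exy; rewrite inE; exists u.
Qed.

End Counting.

(** * Disjoint translates of balls *)

Lemma ereal_gt0_fin {R : realType} (x : \bar R) :
  (0 < x)%E -> exists2 c : R, 0 < c & (c%:E < x)%E.
Proof.
case: x => [x||] //= x0; last by exists 1; rewrite ?ltry.
by exists (x / 2); rewrite ?lte_fin ?divr_gt0// ltr_pdivrMr// ltr_pMr// ltr1n.
Qed.

Section Balls.
Context {R : realType} {V : choiceType} {A : finType}.
Implicit Types (X : set (config V A)) (Phi : config V A -> config V A).
Implicit Types (U W : set V) (u v w : V) (tau : V -> V) (k m n r : nat).

(* An input of [tau w] must be hit by [tau], since [Phi(a)_(tau w)] equals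
   [Phi(tau_* a)_w], which only reads [a] on the range of [tau]. *)
Lemma inputs_image Phi tau w : subisometry Phi tau ->
  pullback tau \o Phi = Phi \o pullback tau ->
  inputs Phi (tau w) = tau @` inputs Phi w.
Proof.
move=> [injt arrt] comm; apply/seteqP; split=> [v|_ [v vw <-]];
  last exact: (proj1 (arrt v w)).
move=> vtw; case: (vtw) => a [a' [aa' neq]].
have [[u utau]|nv] := pselect (exists u, tau u = v).
  by exists u => //; apply: (proj2 (arrt u w)); rewrite utau.
case: neq; have E b : Phi b (tau w) = Phi (pullback tau b) w.
  by have /(congr1 (fun f => f b w)) := comm.
rewrite !E; congr (Phi _ w); apply/funext => x; apply: aa' => xv.
by apply: nv; exists x.
Qed.

Lemma ball_step_image Phi tau U : subisometry Phi tau ->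
  pullback tau \o Phi = Phi \o pullback tau ->
  ball_step Phi (tau @` U) = tau @` ball_step Phi U.
Proof.
move=> isot comm; apply/seteqP; split.
  move=> v [[u Uu <-]|[_ [u Uu <-]]]; first by exists u => //; left.
  rewrite /arrow inputs_image// => -[x xu <-]; exists x => //.
  by right; exists u.
move=> _ [v [Uv|[u Uu vu]] <-]; first by left; exists v.
by right; exists (tau u); [exists u|exact: (proj1 (proj2 isot v u))].
Qed.

Lemma pball_iter_image Phi tau k v r : subisometry Phi tau ->
  pullback tau \o Phi = Phi \o pullback tau ->
  pball Phi (iter k tau v) r = iter k tau @` pball Phi v r.
Proof.
move=> isot comm.
have step U : net_ball Phi (tau @` U) r = tau @` net_ball Phi U r.
  rewrite /net_ball; elim: r => //= r IHr.
  by rewrite IHr ball_step_image.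
rewrite /pball; elim: k => [|k IHk] /=; first by rewrite image_id.
by rewrite -image_set1 step IHk image_comp.
Qed.

Lemma pball_path Phi v r u : pball Phi v r u ->
  exists p : seq V, [/\ path (fun x y => `[< arrow Phi x y \/ arrow Phi y x >]) v p,
    last v p = u & (size p <= r)%N].
Proof.
rewrite /pball /net_ball; elim: r u => [u ->|r IHr u [/IHr[p [ep <- sp]]|]] /=.
- by exists [::].
- by exists p; split => //; exact: leqW.
- move=> [w /IHr[p [ep pw sp]] uw]; exists (rcons p u).
  rewrite rcons_path last_rcons size_rcons ep pw; split => //=.
  by apply/asboolP; right.
Qed.

(** A common point joins the centres: follow the path from [v] to it, then the path from [w]
    backwards. *)
Lemma net_dist_le Phi v w r : pball Phi v r `&` pball Phi w r !=set0 ->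
  (net_dist Phi v w <= (r + r)%N%:R%:E :> \bar R)%E.
Proof.
move=> [u [/pball_path[p [ep pu sp]] /pball_path[q [eq qu sq]]]].
apply: (@le_trans _ _ (size (p ++ rev (belast w q)))%:R%:E); last first.
  by rewrite lee_fin ler_nat size_cat size_rev size_belast leq_add.
apply: ereal_inf_lbound; exists (p ++ rev (belast w q)) => //; split.
  rewrite cat_path ep pu -qu rev_path /=.
  by apply: sub_path eq => x y /asboolP[?|?]; apply/asboolP; [right|left].
rewrite last_cat pu -qu; case: (q) => //= y s.
by rewrite rev_cons last_rcons.
Qed.

Lemma moving_disjoint Phi tau v : moving R Phi tau ->
  exists M, forall r k, (0 < r)%N -> (0 < k)%N ->
    pball Phi v r `&` pball Phi (iter (M * r * k) tau v) r = set0.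
Proof.
move=> /(_ v)[cvgs /ereal_gt0_fin[c c0 cL]].
have [n0 _ Hn0] := cvgs _ (open_ereal_gt' cL).
have cbound : 2 / c < (Num.bound (2 / c))%:R.
  by rewrite archi_boundP// divr_ge0// ltW.
(* The summand [n0] puts every [M * r * k] past the threshold; the other gives [c * M >= 2], so the
   distance exceeds [2 * r]. Neither depends on [r]. *)
set M := (n0 + Num.bound (2 / c))%N.
have M0 : (0 < M)%N.
  rewrite addn_gt0 -(ltr0n R (Num.bound _)) (lt_trans _ cbound) ?orbT//.
  by rewrite divr_gt0.
exists M => r k r0 k0; set n := (M * r * k)%N.
have Mn : (M * r <= n)%N by rewrite leq_pmulr.
have n_n0 : (n0 <= n)%N.
  apply: leq_trans Mn; apply: (@leq_trans M); first exact: leq_addr.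
  by rewrite leq_pmulr.
have n_gt0 : 0 < n%:R :> R by rewrite ltr0n !muln_gt0 M0 r0.
apply/eqP/negPn/negP => /set0P /net_dist_le dn.
have := Hn0 n n_n0; rewrite /= /speed_seq ltNge => /negP; apply.
apply: le_trans (lee_wpmul2r _ dn) _; first by rewrite lee_fin invr_ge0 ltW.
rewrite -EFinM lee_fin ler_pdivrMr //.
apply: (@le_trans _ _ (c * (M * r)%N%:R)); last first.
  by rewrite ler_pM2l// ler_nat.
rewrite addnn -mul2n !natrM mulrA ler_pM2r ?ltr0n// mulrC -ler_pdivrMr//.
by rewrite (le_trans (ltW cbound))// ler_nat leq_addl.
Qed.

(** Pulling the injective map [iter (M * r * i) tau] out of both balls reduces indices [i < j] to
    [0] and [j - i]. *)
Lemma moving_trivIset Phi tau v : subisometry Phi tau ->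
  pullback tau \o Phi = Phi \o pullback tau -> moving R Phi tau ->
  exists M, forall r, (0 < r)%N ->
    trivIset [set: nat] (fun k => pball Phi (iter (M * r * k) tau v) r).
Proof.
move=> isot comm /(moving_disjoint _ _ v)[M HM]; exists M => r r0.
apply: ltn_trivIset => j i ij.
have -> : (M * r * j = M * r * i + M * r * (j - i))%N.
  by rewrite -mulnDr subnKC// ltnW.
have injn n : injective (iter n tau).
  by elim: n => //= n IHn x y /(proj1 isot); exact: IHn.
rewrite iterD (pball_iter_image _ _ (M * r * i)%N v)//.
rewrite (pball_iter_image _ _ (M * r * i)%N (iter _ _ _))//.
rewrite -subset0 => _ [[x Bx <-] [y By /injn yx]].
have ji0 : (0 < j - i)%N by rewrite subn_gt0.
suff: (set0 : set V) x by [].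
by rewrite -(HM r _ r0 ji0); split => //; rewrite -yx.
Qed.

End Balls.

(** * Delays for translated windows *)

Section Translates.
Context {V : choiceType} {A : finType}.
Implicit Types (X : set (config V A)) (Phi : config V A -> config V A).
Implicit Types (U W : set V) (tau : V -> V) (k T : nat).

Lemma pullback_iter_image X tau k :
  pullback tau @` X = X -> pullback (iter k tau) @` X = X.
Proof.
move=> tauX; elim: k => [|k IHk]; first exact: image_id.
by rewrite -[in RHS]IHk -[in RHS]tauX image_comp.
Qed.

Lemma pullback_iter_comm Phi tau k (a : config V A) :
  pullback tau \o Phi = Phi \o pullback tau ->
  pullback (iter k tau) (Phi a) = Phi (pullback (iter k tau) a).
Proof.
move=> comm; elim: k a => // k IHk a.
transitivity (pullback (iter k tau) (pullback tau (Phi a))) => //.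
by rewrite -[pullback tau (Phi a)]/((pullback tau \o Phi) a) comm /= IHk.
Qed.

Lemma window_determines_le X Phi W T T' U : (T <= T')%N ->
  window_determines X Phi W T U -> window_determines X Phi W T' U.
Proof.
move=> TT' WU x y Xx Xy Wxy; apply: WU => // n nT.
exact: (Wxy n (leq_trans nT TT')).
Qed.

(** As [tau] commutes with [Phi], each further translation has the delay [T] of the first one, and
    delays add. *)
Lemma window_determines_iter X Phi tau W T k :
  Phi @` X `<=` X -> pullback tau @` X = X ->
  pullback tau \o Phi = Phi \o pullback tau ->
  window_determines X Phi W T (tau @` W) ->
  window_determines X Phi W (k * T) (iter k tau @` W).
Proof.
move=> PhiX tauX comm Wtau; elim: k => [|k IHk].
  by move=> x y _ _ Wxy _ [w Ww <-]; exact: (Wxy 0%N).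
apply: window_determines_window PhiX IHk _.
have -> : iter k.+1 tau @` W = iter k tau @` (tau @` W).
  by rewrite image_comp; apply: eq_imagel => w _; rewrite /= -iterSr.
apply: window_determines_pullback => // [|a].
  by rewrite pullback_iter_image.
exact: pullback_iter_comm.
Qed.

(** Only the cost [k * T] of moving the window grows with [k]; reading the translate of [U] from it
    always costs [T']. *)
Lemma window_determines_translate X Phi tau W T U T' k :
  Phi @` X `<=` X -> pullback tau @` X = X ->
  pullback tau \o Phi = Phi \o pullback tau ->
  window_determines X Phi W T (tau @` W) -> window_determines X Phi W T' U ->
  window_determines X Phi W (T' + k * T) (iter k tau @` U).
Proof.
move=> PhiX tauX comm Wtau WU.
apply: window_determines_window PhiX
  (window_determines_iter _ _ _ _ _ k PhiX tauX comm Wtau) _.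
apply: window_determines_pullback => // [|a].
  by rewrite pullback_iter_image.
exact: pullback_iter_comm.
Qed.

End Translates.

(** * Upper and lower limits *)

Section Limits.
Context {R : realType}.
Implicit Types u : nat -> \bar R.

Lemma limn_esup_gt0 u : (0 < limn_esup u)%E ->
  exists2 h : R, 0 < h & forall n, exists2 m, (n <= m)%N & (h%:E < u m)%E.
Proof.
move=> /ereal_gt0_fin[h h0 hu]; exists h => // n.
(* The upper limit is an infimum of suprema over eventual sets, hence at most the supremum over this
   tail. *)
have : (h%:E < ereal_sup (u @` [set m | (n <= m)%N]))%E.
  apply: (lt_le_trans hu); apply: ereal_inf_lbound.
  by exists [set m | (n <= m)%N] => //; exact: nbhs_infty_ge.
by move=> /ereal_sup_gt[_ [m nm <-]]; exists m.
Qed.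

Lemma limn_einf_pinfty u (K : R) : limn_einf u = +oo%E ->
  exists n, forall m, (n <= m)%N -> (K%:E < u m)%E.
Proof.
move=> /eqP; rewrite /limn_einf eqe_oppLR /= => /eqP supE.
have : (limn_esup (\- u) < (- K)%:E)%E by rewrite supE ltNyr.
move=> /ereal_inf_lt[_ [D [n _ nD] <-] supD]; exists n => m nm.
rewrite -lteN2 -EFinN; apply: le_lt_trans supD; apply: ereal_sup_ubound.
by exists m => //; exact: nD.
Qed.

End Limits.

(** * The double count and the contradiction *)

Lemma mulrn_bounded_le0 {R : archiRealFieldType} (x b : R) :
  (forall n, x *+ n <= b) -> x <= 0.
Proof.
move=> xb; rewrite leNgt; apply/negP => x0.
have b0 : 0 <= b by rewrite -(mulr0n x).
have := archi_boundP (divr_ge0 b0 (ltW x0)).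
by rewrite ltr_pdivrMr// mulr_natl ltNge xb.
Qed.

(* Count the patterns on [N] disjoint translates of the ball in two ways, and
   let [N] tend to infinity: the time [T'] needed to see the ball itself does
   not matter. *)
Lemma log_card_pball_le {R : realType} {V : choiceType} {A : finType}
    (X : set (config V A)) (Phi : config V A -> config V A) (tau : V -> V)
    (W : set V) (v : V) (eps : R) (M T T' r : nat) :
  Phi @` X `<=` X -> subsymmetry X Phi tau -> finite_set W ->
  (forall (N : nat) (B : 'I_N -> set V),
    (forall i, is_net_ball Phi (B i)) -> trivIset [set: 'I_N] B ->
    eps * (\sum_(i < N) log_card X (B i)) <= log_card X (\bigcup_i B i)) ->
  0 < eps -> (0 < r)%N ->
  trivIset [set: nat] (fun k => pball Phi (iter (M * r * k) tau v) r) ->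
  window_determines X Phi W T (tau @` W) ->
  window_determines X Phi W T' (pball Phi v r) ->
  eps * log_card X (pball Phi v r)
    <= log2 (#|A| ^ finite_card W)%N%:R *+ (M * r * T).
Proof.
move=> PhiX [isot tauX comm] finW indep eps0 r0 disj Wtau WB.
set L : R := log2 _; set lc := log_card X _.
(* [L *+ T'.+1] is the part of the upper count that does not grow with [N]; it bounds every multiple
   of the difference. *)
rewrite -subr_le0; apply: (@mulrn_bounded_le0 _ _ (L *+ T'.+1)) => N.
pose B (i : 'I_N) := pball Phi (iter (M * r * i) tau v) r.
have WBk k := window_determines_translate _ _ _ _ _ _ _ k
  PhiX tauX comm Wtau WB.
have lcB i : lc <= log_card X (B i).
  rewrite /B pball_iter_image //; apply: log_card_pullback.
    exact: pullback_iter_image.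
  exact: (proj1 (@window_determines_card R _ _ _ _ _ _ _ finW (WBk _))).
(* All indices are below [N], so this time suffices for every translate. *)
have WU : window_determines X Phi W (T' + M * r * T * N) (\bigcup_i B i).
  move=> x y Xx Xy Wxy u [i _]; rewrite /B pball_iter_image // => Bu.
  apply: (window_determines_le _ _ _ _ _ _ _ (WBk (M * r * i)%N)) Xx Xy Wxy u Bu.
  by rewrite leq_add2l mulnAC leq_mul2l ltnW ?orbT.
have [_ leU] := @window_determines_card R _ _ _ _ _ _ _ finW WU.
have leB : eps * lc *+ N <= eps * \sum_(i < N) log_card X (B i).
  rewrite -mulrnAr ler_pM2l// -[leLHS]mulr_natl -[N in N%:R]card_ord.
  by rewrite mulr_natl -sumr_const ler_sum.
have disjB : trivIset [set: 'I_N] B.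
  by move=> i j _ _ /(disj _ _ I I) /val_inj.
have netB i : is_net_ball Phi (B i) by exists (iter (M * r * i) tau v), r.
have := le_trans leB (le_trans (indep N B netB disjB) leU).
by rewrite -/L mulrnBl -mulrnA lerBlDr -mulrnDr addSn.
Qed.

Theorem theorem2p7 (R : realType) (A : finType) (V : choiceType)
    (V_countably_infinite : ([set: V] #= [set: nat])%card)
    (X : set (config V A)) (Phi : config V A -> config V A)
    (system : symbolic_system X Phi)
    (tau : V -> V) (tau_subsymmetry : subsymmetry X Phi tau)
    (tau_moving : moving R Phi tau)
    (X_weak_independence : weak_independence R Phi X)
    (exists_v : exists v : V,
       superlinear_connectivity R Phi v /\ (0 < upper_entropy R Phi X v)%E) :
  ~ posexpansive X Phi.
Proof.
case: system => -[clX _] cPhi PhiX; case=> W finW injW.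
case: exists_v => v [super /limn_esup_gt0[h h0 entropy]].
case: X_weak_independence => eps eps0 indep.
have [isot tauX comm] := tau_subsymmetry.
have [M disj] := moving_trivIset _ _ v isot comm tau_moving.
have determines := posexpansive_determines _ _ _ _ clX cPhi injW.
have [T Wtau] := determines _ (finite_image tau finW).
set L : R := log2 (#|A| ^ finite_card W)%N%:R.
have L0 : 0 <= L.
  rewrite (_ : 0 = log2 0%N%:R :> R) ?ler_log2_nat//.
  by rewrite /log2 ln0 ?mul0r.
(* Chosen so that [eps * h * K = L *+ (M * T)]: then [K * r < b] and
   [h * b < log_card X (pball Phi v r)], with [b] the size of the ball, contradict
   [log_card_pball_le]. *)
pose K := (L *+ (M * T)) / (eps * h).
have K0 : 0 <= K by rewrite divr_ge0 ?mulrn_wge0// ltW ?mulr_gt0.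
have [r0 growth] := limn_einf_pinfty _ K super.
(* The [1] ensures [0 < r], as [is_net_ball] demands. *)
have [r] := entropy (maxn r0 1); rewrite geq_max => /andP[/growth].
rewrite !lte_fin; set b := finite_card _ => Kb r_gt0 hb.
have r_pos : 0 < r%:R :> R by rewrite ltr0n.
have b_gt0 : 0 < b%:R :> R.
  by have := le_lt_trans K0 Kb; rewrite pmulr_lgt0 ?invr_gt0.
(* [finite_card] vanishes on infinite sets, so [0 < b] forces the ball to be finite. *)
have [T' WB] : exists T', window_determines X Phi W T' (pball Phi v r).
  apply: determines; apply: contrapT => infB.
  move: b_gt0; rewrite /b /finite_card.
  by rewrite /fset_set; case: pselect => // _; rewrite cardfs0 ltxx.
have := log_card_pball_le _ _ _ _ _ _ _ _ _ _ PhiX tau_subsymmetry finW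
  indep eps0 r_gt0 (disj r r_gt0) Wtau WB.
apply/negP; rewrite -ltNge -/L.
rewrite ltr_pdivlMr// in hb; rewrite ltr_pdivlMr// in Kb.
rewrite -(ltr_pM2l eps0) in hb; apply: le_lt_trans hb.
rewrite mulrA -ler_pdivrMl ?mulr_gt0// (le_trans _ (ltW Kb))//.
by rewrite /K mulnAC mulrnA -[_ *+ r]mulr_natr mulrA (mulrC (_^-1)).
Qed.
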